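(* Let $\Gamma\subseteq\mathfrak{S}$ be a set of permutations, each of length at least $2$. Then, in $\mathbb{Q}[[s,t*,q,x]]$, \[ \sum_{n=0}^{\infty}\frac{A_{\Gamma,n}^{(\mathrm{ides},\mathrm{icomaj})}(s,t,q)}{\prod_{i=0}^{n}(1-tq^{i})}x^{n} =\sum_{n=0}^{\infty}\left(\frac{tx}{(1-t)(1-tq)}+\sum_{k=2}^{\infty}R_{\Gamma,k}^{(\mathrm{ides},\mathrm{icomaj})}(s-1,t,q)\frac{x^{k}}{\prod_{i=0}^{k}(1-tq^{i})}\right)^{*\langle n\rangle}. \]
   Context: $\mathfrak{S}_n$ is the set of permutations of $[n]$ in one-line notation ($\mathfrak{S}_0$ = empty permutation), $\mathfrak{S}=\bigsqcup_n\mathfrak{S}_n$. $\operatorname{std}$ of a sequence of distinct integers replaces its letters by $1,2,\dots$ in order of size. For $\pi\in\mathfrak{S}_n$, $\sigma\in\mathfrak{S}_m$, an occurrence of $\sigma$ in $\pi$ is an $i\in[n-m+1]$ with $\operatorname{std}(\pi_i\cdots\pi_{i+m-1})=\sigma$; a marked occurrence of a pattern in $\Gamma$ is a pair $(i,\sigma)$ with $\sigma\in\Gamma$ and $i$ an occurrence of $\sigma$; $\operatorname{occ}_\Gamma(\pi)$ is the number of such pairs. A $\Gamma$-cluster on $\pi\in\mathfrak{S}_n$ is a nonempty set $c$ of marked occurrences such that for every $j\in[n-1]$ some $(i,\sigma)\in c$, $\sigma\in\mathfrak{S}_m$, has $i\le j<i+m-1$; $C_{\Gamma,\pi}$ is the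 set of these and $\operatorname{mk}_\Gamma(c)=|c|$. A descent of $\pi\in\mathfrak{S}_n$ is $i\in[n-1]$ with $\pi_i>\pi_{i+1}$; $\operatorname{des}$ counts descents and $\operatorname{comaj}(\pi)=\sum_{i\text{ descent}}(n-i)$; $\operatorname{ides}(\pi)=\operatorname{des}(\pi^{-1})$, $\operatorname{icomaj}(\pi)=\operatorname{comaj}(\pi^{-1})$. Define $A_{\Gamma,n}^{(\mathrm{ides},\mathrm{icomaj})}(s,t,q)=\sum_{\pi\in\mathfrak{S}_n}s^{\operatorname{occ}_\Gamma(\pi)}t^{\operatorname{ides}(\pi)+1}q^{\operatorname{icomaj}(\pi)}$ for $n\ge1$ and $=1$ for $n=0$, and $R_{\Gamma,k}^{(\mathrm{ides},\mathrm{icomaj})}(s,t,q)=\sum_{\pi\in\mathfrak{S}_k}t^{\operatorname{ides}(\pi)+1}q^{\operatorname{icomaj}(\pi)}\sum_{c\in C_{\Gamma,\pi}}s^{\operatorname{mk}_\Gamma(c)}$. $\mathbb{Q}[[s,t*,q,x]]$ is the algebra of formal power series in $s,t,q,x$ with ordinary multiplication in $s,q,x$ and Hadamard product in $t$: $(\sum_n a_nt^n)*(\sum_n b_nt^n)=\sum_n a_nb_nt^n$. $f^{*\langle n\rangle}$ is the $n$-fold Hadamard product of $f$, with $f^{*\langle 0\rangle}=1/(1-t)$ (the identity). All expressions not marked with $*$ use ordinary multiplication. *)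

(* Defs.v *)
From HB Require Import structures.
From mathcomp Require Import all_boot all_order all_fingroup all_algebra.
From mathcomp Require Import boolp classical_sets.

Set Implicit Arguments.
Unset Strict Implicit.
Unset Printing Implicit Defensive.

Import GRing.Theory.
Local Open Scope ring_scope.

(** ** Univariate formal power series over a commutative ring.
    The multivariate algebra is obtained below by iterating the construction. *)

Record fps (R : Type) := Fps { fps_coef :> nat -> R }.

HB.instance Definition _ (R : Type) := gen_eqMixin (fps R).
HB.instance Definition _ (R : Type) := gen_choiceMixin (fps R).

Lemma fpsP (R : Type) (f g : fps R) : (forall n, f n = g n) -> f = g.
Proof. by case: f g => [f] [g] /= /funext ->. Qed.

Section Ring.
Variable R : comNzRingType.
Implicit Types f g h : fps R.

Definition fps_zero : fps R := Fps (fun _ => 0).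
Definition fps_one : fps R := Fps (fun n => (n == 0)%:R).
Definition fps_opp f : fps R := Fps (fun n => - f n).
Definition fps_add f g : fps R := Fps (fun n => f n + g n).
Definition fps_mul f g : fps R :=
  Fps (fun n => \sum_(i < n.+1) f i * g (n - i)%N).

Fact fps_addA : associative fps_add.
Proof. by move=> f g h; apply: fpsP => n /=; rewrite addrA. Qed.
Fact fps_addC : commutative fps_add.
Proof. by move=> f g; apply: fpsP => n /=; rewrite addrC. Qed.
Fact fps_add0 : left_id fps_zero fps_add.
Proof. by move=> f; apply: fpsP => n /=; rewrite add0r. Qed.
Fact fps_addN : left_inverse fps_zero fps_opp fps_add.
Proof. by move=> f; apply: fpsP => n /=; rewrite addNr. Qed.

HB.instance Definition _ :=
  GRing.isZmodule.Build (fps R) fps_addA fps_addC fps_add0 fps_addN.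

Definition fps_trunc N f : {poly R} := \poly_(i < N) f i.

Lemma coef_trunc_mul N f g n : (n < N)%N ->
  (fps_trunc N f * fps_trunc N g)`_n = fps_mul f g n.
Proof.
move=> ltnN; rewrite coefM; apply: eq_bigr => i _.
have lei : (i <= n)%N by rewrite -ltnS.
by rewrite !coef_poly (leq_ltn_trans lei ltnN) (leq_ltn_trans (leq_subr _ _) ltnN).
Qed.

Fact fps_mulA : associative fps_mul.
Proof.
move=> f g h; apply: fpsP => n.
have ltn i : (n - i < n.+1)%N by rewrite ltnS leq_subr.
have := congr1 (fun p : {poly R} => p`_n)
  (mulrA (fps_trunc n.+1 f) (fps_trunc n.+1 g) (fps_trunc n.+1 h)).
rewrite !coefM => /=.
under eq_bigr => i _ do rewrite coef_poly ltn_ord coef_trunc_mul //.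
move=> /= ->; apply: eq_bigr => i _.
by rewrite coef_trunc_mul // coef_poly ltn.
Qed.

Fact fps_mulC : commutative fps_mul.
Proof.
move=> f g; apply: fpsP => n.
by rewrite -!(coef_trunc_mul _ _ (ltnSn n)) mulrC.
Qed.

Fact fps_mul1 : left_id fps_one fps_mul.
Proof.
move=> f; apply: fpsP => n /=; rewrite big_ord_recl /= mul1r subn0.
by rewrite big1 ?addr0 // => i _; rewrite mul0r.
Qed.

Fact fps_mulDl : left_distributive fps_mul (@GRing.add (fps R)).
Proof.
move=> f g h; apply: fpsP => n /=; rewrite -big_split /=.
by apply: eq_bigr => i _; rewrite mulrDl.
Qed.

Fact fps_one_neq0 : fps_one != 0.
Proof.
apply/eqP => /(congr1 (fun f : fps R => f 0%N)) /= /eqP.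
by rewrite oner_eq0.
Qed.

HB.instance Definition _ := GRing.Zmodule_isComNzRing.Build (fps R)
  fps_mulA fps_mulC fps_mul1 fps_mulDl fps_one_neq0.

Definition fpsC (a : R) : fps R := Fps (fun n => if n == 0%N then a else 0).
Definition fpsX : fps R := Fps (fun n => (n == 1)%:R).

(* (\sum_n a_n t^n) * (\sum_n b_n t^n) = \sum_n a_n b_n t^n *)
Definition hadamard f g : fps R := Fps (fun n => f n * g n).

Lemma fps0E n : (0 : fps R) n = 0. Proof. by []. Qed.
Lemma fps1E n : (1 : fps R) n = (n == 0)%:R. Proof. by []. Qed.
Lemma fpsNE f n : (- f) n = - f n. Proof. by []. Qed.
Lemma fpsDE f g n : (f + g) n = f n + g n. Proof. by []. Qed.
Lemma fpsME f g n : (f * g) n = \sum_(i < n.+1) f i * g (n - i)%N.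
Proof. by []. Qed.
End Ring.

Section UnitRing.
Variable R : comUnitRingType.
Implicit Types f g : fps R.

Definition fps_unit : {pred fps R} := fun f => f 0%N \is a GRing.unit.

(* The first n+1 coefficients of 1/f:
   g_0 = 1/f_0 and g_m = - (1/f_0) \sum_(j < m) g_j f_(m-j). *)
Fixpoint fps_inv_seq f n : seq R :=
  if n is m.+1 then
    let s := fps_inv_seq f m in
    rcons s (- (f 0%N)^-1 * \sum_(j < m.+1) s`_j * f (m.+1 - j)%N)
  else [:: (f 0%N)^-1].

(* As everywhere in MathComp, the inverse of a non-unit is itself. *)
Definition fps_inv f : fps R :=
  if fps_unit f then Fps (fun n => (fps_inv_seq f n)`_n) else f.

Lemma size_fps_inv_seq f n : size (fps_inv_seq f n) = n.+1.
Proof. by elim: n => //= n IHn; rewrite size_rcons IHn. Qed.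

Lemma nth_fps_inv_seq f n j : (j <= n)%N ->
  (fps_inv_seq f n)`_j = (fps_inv_seq f j)`_j.
Proof.
elim: n => [|n IHn]; first by rewrite leqn0 => /eqP ->.
rewrite leq_eqVlt => /orP[/eqP -> //|]; rewrite ltnS => lejn.
by rewrite /= nth_rcons size_fps_inv_seq ltnS lejn IHn.
Qed.

Fact fps_mulVx : {in fps_unit, left_inverse 1 fps_inv *%R}.
Proof.
move=> f Uf; have Uf0 : f 0%N \is a GRing.unit by [].
have {Uf}-> : fps_inv f = Fps (fun n => (fps_inv_seq f n)`_n).
  by rewrite /fps_inv; have -> : fps_unit f by [].
apply: fpsP => -[|n]; rewrite fpsME fps1E /=.
  by rewrite big_ord1 /= mulVr.
rewrite big_ord_recr /= subnn nth_rcons size_fps_inv_seq ltnn eqxx.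
rewrite !mulNr mulrAC mulVr // mul1r.
apply/eqP; rewrite subr_eq0; apply/eqP/eq_bigr => i _.
by rewrite -(@nth_fps_inv_seq f n) // -ltnS.
Qed.

Fact fps_unitPl f g : g * f = 1 -> fps_unit f.
Proof.
move=> /(congr1 (fun h : fps R => h 0%N)); rewrite fpsME big_ord1 fps1E /= => e.
by apply/unitrPr; exists (g 0%N); rewrite mulrC.
Qed.

Fact fps_inv_out : {in [predC fps_unit], fps_inv =1 id}.
Proof. by move=> f nUf; rewrite /fps_inv ifN. Qed.

HB.instance Definition _ := GRing.ComNzRing_hasMulInverse.Build (fps R)
  fps_mulVx fps_unitPl fps_inv_out.

(* The n-fold Hadamard product; the identity for it is 1/(1-t). *)
Definition hadamard_exp f n : fps R := iter n (hadamard f) (1 - fpsX R)^-1.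
End UnitRing.

(** ** The algebra Q[[s,t*,q,x]].
    The outermost variable is t, so that the coefficients a_n of the Hadamard
    product are those of \sum_n a_n t^n with a_n in Q[[s,q,x]]; the ring
    operations of [psstqx] are the ordinary ones in all four variables. *)

Definition psx : comUnitRingType := fps rat.
Definition psqx : comUnitRingType := fps psx.
Definition pssqx : comUnitRingType := fps psqx.
Definition psstqx : comUnitRingType := fps pssqx.

Definition vt : psstqx := fpsX pssqx.
Definition vs : psstqx := fpsC (fpsX psqx : pssqx).
Definition vq : psstqx := fpsC (fpsC (fpsX psx : psqx) : pssqx).
Definition vx : psstqx := fpsC (fpsC (fpsC (fpsX rat : psx) : psqx) : pssqx).

(* Coefficient of s^a t^b q^c x^d. *)
Definition coef4 (f : psstqx) (a b c d : nat) : rat :=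
  ((((f : fps pssqx) b : fps psqx) a : fps psx) c : fps rat) d.

(* \sum_(k >= m) u k = S in the usual topology of formal power series: every
   coefficient of the partial sums is eventually that of S. *)
Definition is_fps_sum (m : nat) (u : nat -> psstqx) (S : psstqx) : Prop :=
  forall a b c d, exists N0, forall N, (N0 <= N)%N ->
    coef4 (\sum_(m <= k < N) u k) a b c d = coef4 S a b c d.

Definition fps_summable (m : nat) (u : nat -> psstqx) : Prop :=
  exists S, is_fps_sum m u S.

Definition fps_sum (m : nat) (u : nat -> psstqx) : psstqx :=
  xget 0 [set S | is_fps_sum m u S]%classic.

(* [fps_sum] is 0 on non-summable families, and the sum otherwise. *)
Lemma fps_sumP m u : fps_summable m u -> is_fps_sum m u (fps_sum m u).
Proof. by move=> [S uS]; apply: (@xgetPex _ 0 (is_fps_sum m u)); exists S. Qed.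

Lemma is_fps_sum_unique m u S T :
  is_fps_sum m u S -> is_fps_sum m u T -> S = T.
Proof.
move=> uS uT; apply: fpsP => b; apply: fpsP => a; apply: fpsP => c.
apply: fpsP => d; have [N1 h1] := uS a b c d; have [N2 h2] := uT a b c d.
have := h2 _ (leq_maxr N1 N2); rewrite (h1 _ (leq_maxl N1 N2)); exact.
Qed.

(** ** Permutations.  Positions and letters are numbered from 1. *)

Section Permutations.
Local Open Scope nat_scope.

Definition one_line n (p : 'S_n) : seq nat := [seq (p i : nat).+1 | i : 'I_n].

Definition std (w : seq nat) : seq nat :=
  [seq (index a (sort leq w)).+1 | a <- w].

(* The second conjunct is i <= n - m + 1. *)
Definition occurrence n m (sigma : 'S_m) (p : 'S_n) (i : nat) : bool :=
  [&& 1 <= i, i + m <= n.+1 &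
      std (take m (drop i.-1 (one_line p))) == one_line sigma].

Definition descent n (p : 'S_n) (i : nat) : bool :=
  nth 0 (one_line p) i.-1 > nth 0 (one_line p) i.
Definition des n (p : 'S_n) : nat := \sum_(1 <= i < n | descent p i) 1.
Definition comaj n (p : 'S_n) : nat := \sum_(1 <= i < n | descent p i) (n - i).
Definition ides n (p : 'S_n) : nat := des p^-1%g.
Definition icomaj n (p : 'S_n) : nat := comaj p^-1%g.

(* A pair (i, sigma), with i <= n and sigma of any length m <= n; a longer
   sigma has no occurrence in a permutation of [n]. *)
Definition marked n : finType := ('I_n.+1 * {m : 'I_n.+1 & 'S_m})%type.

Definition mpos n (o : marked n) : nat := o.1.
Definition mlen n (o : marked n) : nat := tag o.2.
Definition mpat n (o : marked n) : 'S_(mlen o) := tagged o.2.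

(* A set of permutations is given by its members Gamma m of each length m. *)
Variable Gamma : forall m, {set 'S_m}.

Definition marked_occ n (p : 'S_n) : {set marked n} :=
  [set o | (mpat o \in Gamma (mlen o)) && occurrence (mpat o) p (mpos o)].

Definition occ n (p : 'S_n) : nat := #|marked_occ p|.

(* The index j ranges over 1 <= j <= n - 1. *)
Definition is_cluster n (p : 'S_n) (c : {set marked n}) : bool :=
  [&& c != finset.set0, c \subset marked_occ p &
      [forall j : 'I_n, (1 <= j) ==>
        [exists o in c, mpos o <= j < mpos o + mlen o - 1]]].

Definition clusters n (p : 'S_n) : {set {set marked n}} :=
  [set c | is_cluster p c].

End Permutations.

(** ** The polynomials A and R, evaluated in a commutative ring. *)

Section Polynomials.
Variables (Gamma : forall m, {set 'S_m}) (K : comNzRingType).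

Definition A_poly (n : nat) (s t q : K) : K :=
  if n == 0%N then 1
  else \sum_(p : 'S_n) s ^+ occ Gamma p * t ^+ (ides p).+1 * q ^+ icomaj p.

Definition R_poly (k : nat) (s t q : K) : K :=
  \sum_(p : 'S_k) t ^+ (ides p).+1 * q ^+ icomaj p *
    \sum_(c in clusters Gamma p) s ^+ #|c|.

End Polynomials.

(* Main.v *)
From HB Require Import structures.
Require Import Defs.
From mathcomp Require Import all_boot all_order all_fingroup all_algebra.
From mathcomp Require Import zify ring.
Import GRing.Theory.
Local Open Scope ring_scope.

(** Fix the exponent [b] of [t].  By Stanley's theory of P-partitions,
    [t^(ides p + 1) q^(icomaj p) / \prod_(i <= n) (1 - t q^i)] has as coefficient
    of [t^b] the generating function, by sum of letters, of the words of length
    [n] over [{0, ..., b-1}] whose standardization is [p].  So the coefficient of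
    [t^b] of the left-hand side counts all words over [{0, ..., b-1}] by the
    occurrences of [Gamma] in their standardizations, the Hadamard product in [t]
    becomes the ordinary product at fixed [b], and concatenation of words gives a
    Goulden-Jackson cluster expansion: expanding [s^occ] as
    [\sum_S (s-1)^|S|] over sets [S] of marked occurrences, and cutting [S] at its
    first gap not covered by a marked occurrence, yields
    [W_n = \sum_(1 <= k <= n) G_k W_(n-k)], i.e. [W = 1 / (1 - G)]. *)

Set Implicit Arguments.
Unset Strict Implicit.

(** * Coefficients of power series *)

Section SeriesCoefficients.
Variable R : comNzRingType.
Implicit Types (a : R) (f : fps R).

Lemma fpsCM a f n : (fpsC a * f) n = a * f n.
Proof.
rewrite fpsME big_ord_recl /= subn0 big1 ?addr0 // => i _.
by rewrite mul0r.
Qed.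

Lemma fpsXM0 f : (fpsX R * f) 0%N = 0.
Proof. by rewrite fpsME big_ord1 /= mul0r. Qed.

Lemma fpsXMS f n : (fpsX R * f) n.+1 = f n.
Proof.
rewrite fpsME big_ord_recl /= mul0r add0r big_ord_recl /= mul1r subSS subn0.
by rewrite big1 ?addr0 // => i _; rewrite mul0r.
Qed.

Fact fpsC_is_zmod_morphism : zmod_morphism (@fpsC R).
Proof. by move=> a b; apply: fpsP => -[|n]; rewrite fpsDE fpsNE //= subrr. Qed.

Fact fpsC_is_monoid_morphism : monoid_morphism (@fpsC R).
Proof.
split=> [|a b]; apply: fpsP => n; first by case: n.
by rewrite fpsCM; case: n => [|n] //=; rewrite mulr0.
Qed.

HB.instance Definition _ :=
  GRing.isZmodMorphism.Build R (fps R) (@fpsC R) fpsC_is_zmod_morphism.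
HB.instance Definition _ :=
  GRing.isMonoidMorphism.Build R (fps R) (@fpsC R) fpsC_is_monoid_morphism.

Lemma fps_sumE I (r : seq I) (P : pred I) (F : I -> fps R) n :
  (\sum_(i <- r | P i) F i) n = \sum_(i <- r | P i) F i n.
Proof. by elim/big_rec2: _ => //= i x y _ <-. Qed.

End SeriesCoefficients.

(** * Words over [{0, ..., b-1}] and chains *)

Fixpoint words (b n : nat) : seq (seq nat) :=
  if n is m.+1 then [seq a :: w | a <- iota 0 b, w <- words b m] else [:: [::]].

Lemma mem_words b n w :
  (w \in words b n) = (size w == n) && all (fun a => (a < b)%N) w.
Proof.
elim: n w => [|n IHn] [|a w] //=; first by apply/allpairsP => -[[? ?] [_ _]].
rewrite eqSS; apply/allpairsP/idP.
  case=> -[a' w'] /= [a'b w'n [-> ->]]; move: a'b w'n.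
  by rewrite mem_iota /= add0n IHn => -> /andP[-> ->].
case/and3P => sw ab wb; exists (a, w); split => //=.
  by rewrite mem_iota.
by rewrite IHn sw.
Qed.

Lemma words_uniq b n : uniq (words b n).
Proof.
elim: n => //= n IHn; apply: allpairs_uniq => //; first exact: iota_uniq.
by move=> [a w] [a' w'] _ _ /= [-> ->].
Qed.

Lemma big_words_cat (V : nmodType) b k m (f : seq nat -> V) :
  \sum_(w <- words b (k + m)) f w =
  \sum_(u <- words b k) \sum_(v <- words b m) f (u ++ v).
Proof.
elim: k f => [|k IHk] f; first by rewrite big_seq1.
rewrite addSn /= !big_allpairs_dep.
by apply: eq_bigr => a _; rewrite (IHk (fun w => f (a :: w))).
Qed.

(* [w] is weakly increasing, starting from [l], with a strict step wherever
   [ds] is true. *)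
Fixpoint chain (l : nat) (ds : seq bool) (w : seq nat) : bool :=
  match ds, w with
  | d :: ds', a :: w' => (l + d <= a)%N && chain a ds' w'
  | _, _ => true
  end.

Lemma chainP l ds w : size w = size ds ->
  reflect (forall i, (i < size ds)%N ->
             (nth 0%N (l :: w) i + nth false ds i <= nth 0%N w i)%N)
          (chain l ds w).
Proof.
elim: ds l w => [|d ds IHds] l [|a w] //=; first by left.
case=> sw; apply: (iffP andP) => [[lda /(IHds _ _ sw) h] [|i] //=|h].
  exact: h.
split; first exact: (h 0%N).
by apply/(IHds _ _ sw) => i iw; apply: (h i.+1).
Qed.

Lemma iota0S b : iota 0 b.+1 = 0%N :: map succn (iota 0 b).
Proof. exact: (congr1 (cons 0%N) (iotaDl 1 0 b)). Qed.

(** * Generating series of chains *)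

Section ChainSeries.
Variables (R : comUnitRingType) (q : R).

Definition chain_sum l ds b : R :=
  \sum_(w <- words b (size ds) | chain l ds w) q ^+ sumn w.

Lemma chain_sum_nil l b : chain_sum l [::] b = 1.
Proof. by rewrite /chain_sum big_mkcond big_seq1. Qed.

Lemma chain_sum_cons l d ds b :
  chain_sum l (d :: ds) b =
  \sum_(a <- iota 0 b | (l + d <= a)%N) q ^+ a * chain_sum a ds b.
Proof.
rewrite /chain_sum /= big_mkcond big_allpairs_dep [RHS]big_mkcond /=.
apply: eq_bigr => a _; case: leqP => _ /=; last by rewrite big1.
by rewrite -big_mkcond mulr_sumr; apply: eq_bigr => w _; rewrite exprD.
Qed.

Lemma chain_sum0 l d ds : chain_sum l (d :: ds) 0 = 0.
Proof. by rewrite chain_sum_cons big_nil. Qed.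

(** All letters of a chain that starts from [l.+1] are positive, so each can be lowered by 1, which
    costs one [q] per letter. *)
Lemma chain_sum_shift l ds b :
  chain_sum l.+1 ds b.+1 = q ^+ size ds * chain_sum l ds b.
Proof.
elim: ds l => [|d ds IHds] l; first by rewrite !chain_sum_nil mulr1.
rewrite !chain_sum_cons iota0S big_cons big_map mulr_sumr.
by apply: eq_bigr => a _; rewrite IHds /= !exprS; ring.
Qed.

(** Either the first letter is 0 and can be deleted, or all letters are positive and
    [chain_sum_shift] applies. *)
Lemma chain_sum_false ds b :
  chain_sum 0 (false :: ds) b.+1 =
  chain_sum 0 ds b.+1 + q ^+ (size ds).+1 * chain_sum 0 (false :: ds) b.
Proof.
rewrite -(chain_sum_shift 0 (false :: ds)) !chain_sum_cons iota0S !big_cons.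
by rewrite expr0 mul1r !big_map.
Qed.

(** A strict step from 0 is a weak step from 1. *)
Lemma chain_sum_true ds b :
  chain_sum 0 (true :: ds) b.+1 = q ^+ (size ds).+1 * chain_sum 0 (false :: ds) b.
Proof.
by rewrite -(chain_sum_shift 0 (false :: ds)) !chain_sum_cons.
Qed.

Definition chain_series ds : fps R := Fps (chain_sum 0 ds).

Let t := fpsX R.
Let Q := fpsC q.

Lemma chain_series_nil : chain_series [::] * (1 - t) = 1.
Proof.
apply: fpsP => -[|b]; rewrite mulrBr mulr1 mulrC fpsDE fpsNE.
  by rewrite fpsXM0 subr0 /= chain_sum_nil.
by rewrite fpsXMS /= !chain_sum_nil subrr.
Qed.

(** The two recurrences above, read as identities in [t]. The correction removes the empty word over
    the empty alphabet, to which no longer word corresponds. *)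
Lemma chain_series_cons d ds :
  chain_series (d :: ds) * (1 - t * Q ^+ (size ds).+1) =
  (t * Q ^+ (size ds).+1) ^+ d * (chain_series ds - (ds == [::])%:R).
Proof.
have false_case: chain_series (false :: ds) * (1 - t * Q ^+ (size ds).+1) =
    chain_series ds - (ds == [::])%:R.
  apply: fpsP => b; rewrite mulrBr mulr1 mulrC -mulrA -rmorphXn !fpsDE !fpsNE.
  case: b => [|b].
    rewrite fpsXM0 subr0 /= chain_sum0.
    case: ds => [|d' ds]; first by rewrite chain_sum_nil fps1E subrr.
    by rewrite /= chain_sum0 subr0.
  rewrite fpsXMS fpsCM /= chain_sum_false addrK; case: eqP => _.
    by rewrite fps1E subr0.
  by rewrite fps0E subr0.
case: d; last by rewrite expr0 mul1r.
rewrite expr1 -false_case mulrA; congr (_ * _).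
apply: fpsP => b; rewrite -mulrA -rmorphXn; case: b => [|b].
  by rewrite fpsXM0; exact: chain_sum0.
by rewrite fpsXMS fpsCM; exact: chain_sum_true.
Qed.

(** A strict step at index [i] raises all [(size ds).+1 - i] letters from [i] on. The factor [1 - t]
    and the leading [t] come from the empty chain, through [1/(1 - t) - 1 = t/(1 - t)]. *)
Lemma chain_series_prod d ds :
  chain_series (d :: ds) * \prod_(0 <= i < (size ds).+2) (1 - t * Q ^+ i) =
  t * \prod_(0 <= i < (size ds).+1)
        (t * Q ^+ ((size ds).+1 - i)) ^+ nth false (d :: ds) i.
Proof.
elim: ds d => [|d' ds IHds] d; rewrite big_nat_recr //=.
  rewrite [X in _ * X = _]mulrC mulrA chain_series_cons !big_nat1.
  have -> : chain_series [::] - 1 = chain_series [::] * t.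
    by rewrite -[1 in LHS]chain_series_nil mulrBr mulr1 opprB addrCA subrr addr0.
  rewrite expr0 mulr1 -mulrA [X in _ * X]mulrAC chain_series_nil mul1r.
  by rewrite mulrC subn0.
rewrite [X in _ * X = _]mulrC mulrA chain_series_cons subr0 -mulrA.
rewrite IHds mulrCA [in RHS]big_nat_recl //= subn0.
Qed.

End ChainSeries.

(** * Standardization of words and occurrences of patterns *)

Section Standardization.
Local Open Scope nat_scope.

Definition word_lt (w : seq nat) (i j : nat) : bool :=
  (nth 0 w i < nth 0 w j) || (nth 0 w i == nth 0 w j) && (i < j).

Lemma word_lt_irr w i : word_lt w i i = false.
Proof. by rewrite /word_lt !ltnn andbF. Qed.

Lemma word_lt_trans w : transitive (word_lt w).
Proof.
move=> j i k; rewrite /word_lt => /orP[ij|/andP[/eqP-> ij]].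
  by case/orP=> [/(ltn_trans ij)->//|/andP[/eqP<- _]]; rewrite ij.
by case/orP=> [->//|/andP[-> /(ltn_trans ij)->]]; rewrite orbT.
Qed.

Lemma word_lt_total w i j : i != j -> word_lt w i j || word_lt w j i.
Proof.
by rewrite /word_lt eq_sym; case: ltngtP => //= _; case: ltngtP.
Qed.

Lemma word_lt_drop w a i j : word_lt (drop a w) i j = word_lt w (a + i) (a + j).
Proof. by rewrite /word_lt !nth_drop ltn_add2l. Qed.

Section Std.
Variables (n : nat) (w : seq nat).

Definition word_rank (i : 'I_n) : nat := #|[set j : 'I_n | word_lt w j i]|.

Lemma word_rank_homo (i j : 'I_n) : word_lt w i j -> word_rank i < word_rank j.
Proof.
move=> ij; apply/proper_card/properP; split.
  by apply/subsetP => k; rewrite !inE => /word_lt_trans; apply.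
by exists i; rewrite !inE // word_lt_irr.
Qed.

Lemma word_rank_lt i : word_rank i < n.
Proof.
rewrite -[X in _ < X]card_ord -cardsT; apply/proper_card/properP; split.
  exact: subsetT.
by exists i; rewrite inE ?word_lt_irr.
Qed.

Lemma word_rank_inj : injective (fun i => Ordinal (word_rank_lt i)).
Proof.
move=> i j /(congr1 val) /= rij; apply/eqP/negPn/negP => ij.
by case/orP: (word_lt_total w ij) => /word_rank_homo; rewrite rij ltnn.
Qed.

(* Equal letters are numbered from left to right; only the first n letters
   matter. *)
Definition stdperm : 'S_n := perm word_rank_inj.

Lemma stdperm_lt (i j : 'I_n) : (stdperm i < stdperm j) = word_lt w i j.
Proof.
rewrite !permE /=; apply/idP/idP; last exact: word_rank_homo.
apply: contraLR => nij; rewrite -leqNgt.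
have [->//|] := eqVneq i j => /(word_lt_total w); rewrite (negPf nij) /=.
by move/word_rank_homo/ltnW.
Qed.

End Std.

Lemma card_perm_lt n (p : 'S_n) (i : 'I_n) : #|[set j | p j < p i]| = p i.
Proof.
rewrite -(card_imset _ (@perm_inj _ p)).
have -> : p @: [set j | p j < p i] = [set k : 'I_n | k < p i].
  apply/setP => k; rewrite inE; apply/imsetP/idP => [[j]|kp].
    by rewrite inE => ? ->.
  by exists (p^-1%g k); rewrite ?inE permKV.
by rewrite -sum1dep_card (big_ord_narrow (ltnW (ltn_ord _))) sum1_card card_ord.
Qed.

(** The value [p i] is the number of smaller values, so comparisons determine [p]. *)
Lemma perm_lt_inj n (p p' : 'S_n) :
  (forall i j, (p i < p j) = (p' i < p' j)) -> p = p'.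
Proof.
move=> pp'; apply/permP => i; apply/val_inj.
rewrite /= -(card_perm_lt p i) -(card_perm_lt p' i).
by apply: eq_card => j; rewrite !inE pp'.
Qed.

Lemma eq_stdperm n w (p : 'S_n) :
  (forall i j, (p i < p j) = word_lt w i j) -> stdperm n w = p.
Proof. by move=> pw; apply: perm_lt_inj => i j; rewrite stdperm_lt pw. Qed.

Lemma stdperm_cat n u v : size u = n -> stdperm n (u ++ v) = stdperm n u.
Proof.
move=> su; apply: eq_stdperm => i j.
by rewrite stdperm_lt /word_lt !nth_cat su !ltn_ord.
Qed.

Lemma size_one_line n (p : 'S_n) : size (one_line p) = n.
Proof. by rewrite size_map -cardE card_ord. Qed.

Lemma nth_one_line n (p : 'S_n) (i : 'I_n) : nth 0 (one_line p) i = (p i).+1.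
Proof. by rewrite (nth_map i) ?nth_ord_enum // size_enum_ord. Qed.

Lemma one_line_uniq n (p : 'S_n) : uniq (one_line p).
Proof.
by rewrite map_inj_uniq ?enum_uniq // => i j [/val_inj/perm_inj].
Qed.

(** The index in the sorted list grows with the letter, so [std s] is the one-line notation of a
    permutation, which is known by its comparisons. *)
Lemma std_one_line m (s : seq nat) (sigma : 'S_m) : size s = m -> uniq s ->
  (std s == one_line sigma) =
  [forall x : 'I_m, forall y : 'I_m,
     (sigma x < sigma y) == (nth 0 s x < nth 0 s y)].
Proof.
move=> sm us; set r := sort leq s.
have mr (x : 'I_m) : nth 0 s x \in r by rewrite mem_sort mem_nth ?sm.
have sr : sorted ltn r.
  by rewrite ltn_sorted_uniq_leq sort_uniq us (sort_sorted leq_total).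
have ixlt (x y : 'I_m) :
    (index (nth 0 s x) r < index (nth 0 s y) r) = (nth 0 s x < nth 0 s y).
  apply/idP/idP; first exact: (sorted_ltn_index ltn_trans sr).
  apply: contraLR; rewrite -!leqNgt.
  apply: (sorted_leq_index leq_trans leqnn) => //.
  exact: (sort_sorted leq_total).
have ixm (x : 'I_m) : index (nth 0 s x) r < m.
  by rewrite -[X in _ < X]sm -(size_sort leq) index_mem mr.
have ixinj : injective (fun x => Ordinal (ixm x)).
  move=> x y /(congr1 val) /= /(congr1 (nth 0 r)); rewrite !nth_index //.
  by move/eqP; rewrite nth_uniq ?sm // => /eqP/val_inj.
have -> : (std s == one_line sigma) = (perm ixinj == sigma).
  have nth_std (x : 'I_m) : nth 0 (std s) x = (perm ixinj x).+1.
    by rewrite permE /= (nth_map 0) ?sm.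
  apply/eqP/eqP => [e|<-].
    apply/permP => x; apply/val_inj/succn_inj.
    by rewrite -nth_std e nth_one_line.
  apply: (@eq_from_nth _ 0) => [|i]; rewrite size_map ?size_one_line sm // => im.
  by rewrite (nth_std (Ordinal im)) -nth_one_line.
apply/eqP/forallP => [<- x|h].
  by apply/forallP => y; rewrite !permE /= ixlt.
apply: perm_lt_inj => x y; rewrite !permE /= ixlt.
by have /forallP/(_ y)/eqP-> := h x.
Qed.

(** Standardizing keeps the order [word_lt] of the positions, and passing to a factor only shifts
    it; so patterns can be read off the word itself. *)
Lemma occurrence_stdperm n m w (sigma : 'S_m) i :
  occurrence sigma (stdperm n w) i =
  [&& 1 <= i, i + m <= n.+1 & stdperm m (drop i.-1 w) == sigma].
Proof.
rewrite /occurrence; case: i => [//|a] /=; rewrite addSn ltnS.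
case: leqP => //= amn; rewrite std_one_line; first 1 last.
- by rewrite size_takel // size_drop size_one_line; lia.
- by rewrite take_uniq ?drop_uniq ?one_line_uniq.
have nthE (x : 'I_m) (xn : a + x < n) :
    nth 0 (take m (drop a (one_line (stdperm n w)))) x =
    (stdperm n w (Ordinal xn)).+1.
  by rewrite nth_take // nth_drop -nth_one_line.
have axn (x : 'I_m) : a + x < n by rewrite (leq_trans _ amn) // ltn_add2l.
apply/forallP/eqP => [h|<- x].
  apply: eq_stdperm => x y; have /forallP/(_ y)/eqP-> := h x.
  by rewrite !nthE ltnS stdperm_lt word_lt_drop.
by apply/forallP => y; rewrite !nthE ltnS !stdperm_lt word_lt_drop.
Qed.

End Standardization.

(** * Words with a given standardization, as chains *)

Section WordsOfPermutation.
Variables (n : nat) (p : 'S_n).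
Local Open Scope nat_scope.

(** The letters of [w] in the order in which [p] numbers their positions. *)
Definition reorder (w : seq nat) : seq nat := [seq nth 0 w (p^-1%g j) | j : 'I_n].

(** Entry 0 compares a value with itself, as [0.-1] is [0], and so is false: the first letter of the
    chain is only bounded below by 0. *)
Definition descents_seq : seq bool := mkseq (descent p^-1%g) n.

Lemma size_reorder w : size (reorder w) = n.
Proof. by rewrite size_map size_enum_ord. Qed.

Lemma nth_reorder w (j : 'I_n) : nth 0 (reorder w) j = nth 0 w (p^-1%g j).
Proof. by rewrite (nth_map j) ?nth_ord_enum ?size_enum_ord. Qed.

Lemma nth_descents_seq i : i < n -> nth false descents_seq i = descent p^-1%g i.
Proof. by move=> ilt; rewrite nth_mkseq. Qed.

Lemma sumn_reorder w : size w = n -> sumn (reorder w) = sumn w.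
Proof.
move=> sw; rewrite !sumnE big_map big_enum (reindex_inj (@perm_inj _ p)) /=.
by rewrite [RHS](big_nth 0) sw big_mkord; apply: eq_bigr => i _; rewrite permK.
Qed.

(** An injection of a finite set into itself is a bijection. *)
Lemma perm_reorder_words b : perm_eq (map reorder (words b n)) (words b n).
Proof.
have sub : {subset map reorder (words b n) <= words b n}.
  move=> _ /mapP[w + ->]; rewrite !mem_words size_reorder eqxx => /andP[/eqP sw].
  move/all_nthP => wb; apply/allP => _ /mapP[j _ ->].
  by apply: wb; rewrite sw.
have un : uniq (map reorder (words b n)).
  rewrite map_inj_in_uniq ?words_uniq // => w w'.
  rewrite !mem_words => /andP[/eqP sw _] /andP[/eqP sw' _] ww'.
  apply: (@eq_from_nth _ 0); rewrite sw ?sw' // => i ilt.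
  have := congr1 (fun v => nth 0 v (p (Ordinal ilt))) ww'.
  by rewrite !nth_reorder permK.
apply: uniq_perm => //; first exact: words_uniq.
by have [] := uniq_min_size un sub; rewrite ?size_map.
Qed.

(** [p] standardizes [w] exactly when the positions [p^-1 0, p^-1 1, ...] increase for [word_lt],
    and consecutive positions suffice for this. *)
Lemma stdperm_chain w : size w = n ->
  (stdperm n w == p) = chain 0 descents_seq (reorder w).
Proof.
move=> sw; have nthp (j : 'I_n) : nth 0 (one_line p^-1%g) j = (p^-1%g j).+1.
  exact: nth_one_line.
(* Two equal letters are in the right order exactly when their positions increase, that is, when
   [p^-1] has no descent here. *)
have step (i : 'I_n) (j : 'I_n) : j = i.+1 :> nat ->
    (nth 0 (reorder w) i + descent p^-1%g j <= nth 0 (reorder w) j) =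
    word_lt w (p^-1%g i) (p^-1%g j).
  move=> ji; have ij : j.-1 = i by rewrite ji.
  rewrite /descent ij !nthp !nth_reorder ltnS /word_lt.
  have: p^-1%g i != p^-1%g j by rewrite (inj_eq perm_inj) -val_eqE /= ji; lia.
  rewrite -val_eqE /=; case: (ltngtP (p^-1%g i) (p^-1%g j)) => //= _ _.
    by rewrite addn0 andbT leq_eqVlt orbC.
  by rewrite addn1 andbF orbF.
have ssize : size (reorder w) = size descents_seq.
  by rewrite size_reorder size_mkseq.
apply/eqP/(chainP _ ssize) => [stdw [|i]|]; rewrite size_mkseq.
- by move=> n0; rewrite nth_descents_seq //= /descent ltnn.
- move=> ilt; have i1lt := ltnW ilt.
  rewrite nth_descents_seq // (step (Ordinal i1lt) (Ordinal ilt)) //.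
  by rewrite -stdperm_lt stdw !permKV /=.
move=> h; apply: eq_stdperm.
(* [u] extends [p^-1] to all naturals, by an arbitrary 0, so that [homo_ltn_in] can pass from
   consecutive to arbitrary arguments. *)
pose u k := if insub k is Some j then p^-1%g j : nat else 0.
have uE (j : 'I_n) : u j = p^-1%g j by rewrite /u valK.
have mono : {in [pred k | k < n] &, {homo u : i j / i < j >-> word_lt w i j}}.
  apply: homo_ltn_in => [j i k|i j _|i]; first exact: word_lt_trans.
  - by move=> jn k /andP[_ kj]; exact: ltn_trans jn.
  - rewrite !inE => ilt i1lt; have := h _ i1lt.
    rewrite nth_descents_seq // (step (Ordinal ilt) (Ordinal i1lt)) //.
    by rewrite -!uE.
have lt_word i j : p i < p j -> word_lt w i j.
  by move=> /mono; rewrite !inE !uE !permK; apply.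
move=> i j; apply/idP/idP; first exact: lt_word.
apply: contraLR; rewrite -leqNgt leq_eqVlt.
case/orP => [/eqP/val_inj/perm_inj->|/lt_word ji]; first by rewrite word_lt_irr.
by apply/negP => /(word_lt_trans ji); rewrite word_lt_irr.
Qed.

End WordsOfPermutation.

(** * The series of a standardization class *)

Section WordSeries.
Variables (R : comUnitRingType) (q : R).

Let t := fpsX R.
Let Q := fpsC q.

(** The words become chains with strict steps at the descents of [p^-1]. In [chain_series_prod] a
    descent [i] gives [t q^(n - i)], and the leading [t] gives the [+ 1] in the exponent. *)
Lemma words_series_prod n (p : 'S_n) : (0 < n)%N ->
  Fps (fun b => \sum_(w <- words b n | stdperm n w == p) q ^+ sumn w) *
    \prod_(0 <= i < n.+1) (1 - t * Q ^+ i) =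
  t ^+ (ides p).+1 * Q ^+ icomaj p.
Proof.
move=> n_gt0.
have -> : Fps (fun b => \sum_(w <- words b n | stdperm n w == p) q ^+ sumn w) =
    chain_series q (descents_seq p).
  apply: fpsP => b; rewrite /= /chain_sum size_mkseq.
  transitivity (\sum_(v <- map (reorder p) (words b n) |
      chain 0 (descents_seq p) v) q ^+ sumn v).
    rewrite big_map big_seq_cond [RHS]big_seq_cond.
    apply: eq_big => [w|w].
      by rewrite mem_words; case: eqP => //= sw; rewrite stdperm_chain.
    by rewrite mem_words => /andP[/andP[/eqP sw _] _]; rewrite sumn_reorder.
  exact/perm_big/perm_reorder_words.
case: n n_gt0 p => // n _ p.
have sd : size (mkseq (fun i => descent p^-1%g i.+1) n) = n by rewrite size_mkseq.
have -> : descents_seq p = false :: mkseq (fun i => descent p^-1%g i.+1) n.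
  by rewrite /descents_seq /mkseq iota0S /= -map_comp {1}/descent ltnn.
have := chain_series_prod q false (mkseq (fun i => descent p^-1%g i.+1) n).
rewrite sd => ->; rewrite exprS -mulrA; congr (_ * _).
rewrite big_nat_recl // mul1r /ides /icomaj /des /comaj.
rewrite (big_mkcond (descent _)) (big_mkcond (fun i => descent _ i)) /=.
rewrite !big_add1 /= -!prodrXr -big_split /=; apply: eq_big_nat => i ilt.
rewrite nth_mkseq //; case: (descent _ _); last by rewrite !expr0 mul1r.
by rewrite !expr1.
Qed.

End WordSeries.

(** * Weighted sums over subsets *)

Section SubsetSums.
Variable R : comNzRingType.
Variable y : R.

Lemma sum_subsets (T : finType) (A : {set T}) :
  \sum_(S : {set T} | S \subset A) y ^+ #|S| = (1 + y) ^+ #|A|.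
Proof.
pose card_S (S : {set T}) : 'I_#|A|.+1 := inord #|S|.
rewrite exprDn (partition_big card_S predT) //=.
apply: eq_bigr => k _; rewrite expr1n mul1r -cards_draws -sumr_const.
transitivity (\sum_(S : {set T} | (S \subset A) && (#|S| == k)) y ^+ k).
  apply: eq_big => [S|S /andP[SA /eqP <-]].
    case SA: (S \subset A) => //=.
    by rewrite -val_eqE /= inordK // ltnS subset_leq_card.
  by rewrite inordK // ltnS subset_leq_card.
by apply: eq_bigl => S; rewrite inE.
Qed.

Lemma sum_subsets_imset (T T' : finType) (f : T -> T') (A : {set T})
    (Q : pred {set T'}) : {in A &, injective f} ->
  \sum_(S : {set T'} | (S \subset f @: A) && Q S) y ^+ #|S| =
  \sum_(S : {set T} | (S \subset A) && Q (f @: S)) y ^+ #|S|.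
Proof.
move=> finj.
(* Injectivity holds on [A] only, so the inverse takes the preimage inside [A]. *)
rewrite (reindex_onto (fun S : {set T} => f @: S)
  (fun S' : {set T'} => A :&: f @^-1: S')) /=.
  apply: eq_big => [S|S /andP[/andP[_ _] /eqP SA]].
    apply/andP/andP => [[/andP[_ QS] /eqP SA]|[SA QS]].
      by split=> //; rewrite -SA subsetIl.
    rewrite imsetS // QS; split=> //; apply/eqP/setP => x; rewrite !inE.
    apply/andP/idP => [[xA /imsetP[z zS]]|xS].
      by move/(finj _ _ xA (subsetP SA _ zS)) ->.
    by rewrite (subsetP SA) // imset_f.
  rewrite card_in_imset // => x z xS zS; apply: finj.
    by move: xS; rewrite -SA inE => /andP[].
  by move: zS; rewrite -SA inE => /andP[].
move=> S' /andP[S'A _]; apply/setP => x; apply/imsetP/idP => [[z]|xS'].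
  by rewrite !inE => /andP[_ ?] ->.
have /imsetP[z zA xz] := subsetP S'A _ xS'.
by exists z => //; rewrite !inE zA -xz.
Qed.

End SubsetSums.

(** * Sets of intervals and their first gap *)

Section Intervals.
Variables (N : nat) (V : nat -> nat -> bool).
Hypothesis V_ltn : forall i j, V i j -> (i < j)%N.
Variable (R : comNzRingType) (y : R).

Let T := ('I_N.+1 * 'I_N.+1)%type.
Implicit Types (S : {set T}) (o : T).

Definition intervals (a b : nat) : {set T} :=
  [set o : T | [&& (a <= o.1)%N, (o.2 <= b)%N & V o.1 o.2]].

(** With letters counted from 0, [o] spans the letters [o.1, ..., o.2 - 1], and [g] is the place
    between the letters [g - 1] and [g]. *)
Definition covered S (g : nat) : bool := [exists o : T in S, (o.1 < g < o.2)%N].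

Definition covers S (a b : nat) : bool :=
  [forall g : 'I_N.+1, (a < g < b)%N ==> covered S g].

(** The default [b] is itself a gap when no interval of [S] ends after [b], so the minimum is then
    over a nonempty set. *)
Definition first_gap S (a b : nat) : 'I_N.+1 :=
  [arg min_(k < inord b | (a < k <= b)%N && ~~ covered S k) (k : nat)]%N.

Lemma first_gapP S (a b : nat) (k : 'I_N.+1) : (b <= N)%N -> (a < k <= b)%N ->
    S \subset intervals a b ->
  (first_gap S a b == k) = ~~ covered S k && covers S a k.
Proof.
move=> bN /andP[ak kb] Sab; rewrite /first_gap; case: arg_minnP => [|m].
  rewrite inordK ?leqnn ?andbT // (leq_trans ak kb) /=.
  apply/existsP => -[o /andP[/(subsetP Sab)]]; rewrite inE => /and3P[_ ob _].
  by rewrite ltnNge [(b < _)%N]ltnNge ob andbF.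
move=> /andP[/andP[am mb] ncm] minm; apply/eqP/andP => [<-|[nck cov]].
  split=> //; apply/forallP => g; apply/implyP => /andP[ag gm].
  apply: contraLR gm => ncg; rewrite -leqNgt.
  have [gb|bg] := leqP g b; first by rewrite minm // ag gb ncg.
  exact: leq_trans mb (ltnW bg).
apply/val_inj/eqP; rewrite eqn_leq /= minm ?ak ?kb //= leqNgt.
apply: contra ncm => mk; move/forallP: cov => /(_ m)/implyP; apply.
by rewrite am.
Qed.

Lemma disjoint_intervals (a k b : nat) : [disjoint intervals a k & intervals k b].
Proof.
apply/pred0P => o /=; rewrite !inE; apply/negP.
case/andP=> /and3P[_ ok /V_ltn oo] /and3P[ko _ _].
by move: (leq_trans ok ko); rewrite leqNgt oo.
Qed.

Lemma intervalsS (a k a' b' : nat) : (a' <= a)%N -> (k <= b')%N ->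
  intervals a k \subset intervals a' b'.
Proof.
move=> aa kb; apply/subsetP => o; rewrite !inE => /and3P[ao ok ->].
by rewrite (leq_trans aa ao) (leq_trans ok kb).
Qed.

(* Cut [S] at its first gap: the part to the left is a cluster, the part to the
   right is arbitrary. *)
Lemma interval_recurrence (a b : nat) : (a < b <= N)%N ->
  \sum_(S : {set T} | S \subset intervals a b) y ^+ #|S| =
  \sum_(k < N.+1 | (a < k <= b)%N)
    (\sum_(S : {set T} | (S \subset intervals a k) && covers S a k) y ^+ #|S|) *
    (\sum_(S : {set T} | S \subset intervals k b) y ^+ #|S|).
Proof.
case/andP=> ab bN.
have bgap S : S \subset intervals a b ->
    (a < @inord N b <= b)%N && ~~ covered S (@inord N b).
  move=> Sab; rewrite inordK // ab leqnn /=.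
  apply/existsP => -[o /andP[/(subsetP Sab)]]; rewrite inE => /and3P[_ ob _].
  by case/andP=> _; rewrite ltnNge ob.
rewrite (partition_big (fun S => first_gap S a b)
  (fun k => (a < k <= b)%N)) /=; last first.
  by move=> S /bgap Sb; rewrite /first_gap; case: arg_minnP => // k /andP[].
apply: eq_bigr => k akb; have [ak kb] := andP akb.
rewrite big_distrl /=; under [RHS]eq_bigr => S1 _ do rewrite big_distrr /=.
rewrite pair_big_dep /=.
rewrite [RHS](reindex_onto (fun S => (S :&: intervals a k, S :&: intervals k b))
  (fun P => P.1 :|: P.2)) /=; last first.
  move=> [S1 S2] /= /andP[/andP[S1a _] S2k]; congr pair.
    rewrite setIUl (setIidPl S1a) (disjoint_setI0 (disjointWl S2k _)) ?setU0 //.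
    by rewrite disjoint_sym disjoint_intervals.
  rewrite setIUl (setIidPl S2k) (disjoint_setI0 (disjointWl S1a _)) ?set0U //.
  exact: disjoint_intervals.
(* No interval crosses the gap [k], so [S] is the union of its traces on the two sides, and the
   places before [k] can only be covered by the left trace. *)
have cond S : (S \subset intervals a b) && (first_gap S a b == k) =
  [&& (S :&: intervals a k \subset intervals a k) &&
        covers (S :&: intervals a k) a k,
      S :&: intervals k b \subset intervals k b &
      (S :&: intervals a k) :|: (S :&: intervals k b) == S].
  apply/andP/and3P => [[Sab]|[/andP[_ cov] _ /eqP SE]].
    rewrite first_gapP // => /andP[nck cov]; split; rewrite ?subsetIr //=.
      apply/forallP => g; apply/implyP => agk; have /andP[ag gk] := agk.
      have /implyP/(_ agk)/existsP[o /andP[oS ogo]] := forallP cov g.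
      apply/existsP; exists o; rewrite ogo andbT !inE oS.
      move: (subsetP Sab _ oS); rewrite inE => /and3P[-> _ ->]; rewrite andbT /=.
      rewrite leqNgt; apply: contra nck => ko; apply/existsP; exists o.
      by rewrite oS ko andbT /=; case/andP: ogo => og _; exact: ltn_trans gk.
    rewrite -setIUr; apply/eqP/setIidPl/subsetP => o oS.
    move: (subsetP Sab _ oS); rewrite !inE => /and3P[-> -> ->]; rewrite !andbT /=.
    have [//|ko] := leqP o.2 k; rewrite leqNgt; apply: contra nck => ok.
    by apply/existsP; exists o; rewrite oS ok ko.
  have Sab : S \subset intervals a b.
    rewrite -SE subUset; apply/andP; split; apply: (subset_trans (subsetIr _ _)).
      exact: intervalsS.
    by apply: intervalsS => //; exact: ltnW.
  rewrite first_gapP //; split=> //; apply/andP; split.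
    apply/existsP => -[o /andP[]]; rewrite -SE !inE; case/orP.
      by case/and4P=> _ _ ok _ /andP[_]; rewrite ltnNge ok.
    by case/and4P=> _ ko _ _ /andP[]; rewrite ltnNge ko.
  apply/forallP => g; apply/implyP => agk.
  have /implyP/(_ agk)/existsP[o /andP[]] := forallP cov g.
  by rewrite inE => /andP[oS _] ogo; apply/existsP; exists o; rewrite oS.
apply: eq_big => [S|S]; first by rewrite cond andbA.
rewrite cond => /and3P[_ _ /eqP {1}<-]; rewrite cardsU -exprD.
rewrite (_ : (_ :&: _ :&: (_ :&: _)) = set0) ?cards0 ?subn0 //.
rewrite setIACA (disjoint_setI0 (disjoint_intervals _ _ _)) setI0 //.
Qed.

End Intervals.

(** * Marked occurrences in words as intervals *)

Section WordClusters.
Variable Gamma : forall m, {set 'S_m}.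
Hypothesis Gamma_ge2 : forall m (sigma : 'S_m), sigma \in Gamma m -> (2 <= m)%N.
Variables (R : comNzRingType) (y : R).

Lemma mem_marked_occ n w (o : marked n) :
  (o \in marked_occ Gamma (stdperm n w)) =
  [&& mpat o \in Gamma (mlen o), (1 <= mpos o)%N, (mpos o + mlen o <= n.+1)%N &
      stdperm (mlen o) (drop (mpos o).-1 w) == mpat o].
Proof. by rewrite inE occurrence_stdperm. Qed.

Definition word_occ (w : seq nat) (i j : nat) : bool :=
  (i < j)%N && (stdperm (j - i) (drop i w) \in Gamma (j - i)).

Lemma word_occ_ltn w i j : word_occ w i j -> (i < j)%N.
Proof. by case/andP. Qed.

Section Transport.
Variables (N k a : nat) (w : seq nat).
Hypothesis akN : (a + k <= N)%N.

(** [mpos] counts from 1, hence the predecessor; [a] is where the factor begins in the whole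
    word. *)
Definition marked_interval (o : marked k) : 'I_N.+1 * 'I_N.+1 :=
  (inord (a + (mpos o).-1), inord (a + (mpos o).-1 + mlen o)).

Let M := marked_occ Gamma (stdperm k (drop a w)).

Lemma marked_interval_val (o : marked k) : o \in M ->
  [/\ (marked_interval o).1 = a + (mpos o).-1 :> nat,
      (marked_interval o).2 = a + (mpos o).-1 + mlen o :> nat &
      [&& (1 <= mpos o), (2 <= mlen o) & (mpos o + mlen o <= k.+1)]]%N.
Proof.
rewrite mem_marked_occ => /and4P[/Gamma_ge2 o2 o1 ok _].
by split; rewrite /= ?inordK //; lia.
Qed.

(** The interval gives position and length, and the pattern is then forced: it is the
    standardization of the factor. *)
Lemma marked_interval_inj : {in M &, injective marked_interval}.
Proof.
move=> o o' oM o'M oo'; have [e1 e2 e3] := marked_interval_val oM.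
have [e1' e2' e3'] := marked_interval_val o'M.
have pos : mpos o = mpos o' by move: e1 e1'; rewrite oo' => ->; lia.
have len : mlen o = mlen o' by move: e2 e2'; rewrite oo' pos => ->; lia.
move: oM o'M; rewrite !mem_marked_occ => /and4P[_ _ _ +] /and4P[_ _ _].
case: o o' pos len {oo' e1 e2 e3 e1' e2' e3'} => [i [m s]] [i' [m' s']].
rewrite /mpos /mlen /mpat /= => /val_inj <- /val_inj mm'.
by case: m' / mm' s' => s' /eqP<- /eqP<-.
Qed.

Lemma marked_interval_imset :
  marked_interval @: M = intervals N (word_occ w) a (a + k).
Proof.
apply/setP => -[i j]; rewrite inE /=; apply/imsetP/and3P.
  case=> o oM oE; have [e1 e2 e3] := marked_interval_val oM.
  have -> : (i : nat) = (a + (mpos o).-1)%N by rewrite -e1 -oE.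
  have -> : (j : nat) = (a + (mpos o).-1 + mlen o)%N by rewrite -e2 -oE.
  split; [lia|lia|].
  move: oM; rewrite mem_marked_occ drop_drop => /and4P[oG _ _ /eqP oo].
  rewrite /word_occ addKn addnC oo oG; lia.
case=> ai jk /andP[ij sG].
have len2 := Gamma_ge2 sG.
have i1 : ((i - a).+1 < k.+1)%N by lia.
have ji : (j - i < k.+1)%N by lia.
(* The position is [i - a + 1], counted from 1 inside the factor. *)
exists (Ordinal i1, Tagged (fun m : 'I_k.+1 => 'S_m)
  (stdperm (Ordinal ji) (drop i w))).
  rewrite mem_marked_occ /mpos /mlen /mpat /= sG drop_drop subnK // eqxx andbT.
  by lia.
congr pair; apply/val_inj; rewrite /= /mpos /mlen /= inordK; lia.
Qed.

(** The letters [g] and [g + 1] counted from 1 are [g - 1] and [g] counted from 0, so the index of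
    the cluster condition is the place [g], moved by [a]. *)
Lemma covered_marked_interval (c : {set marked k}) g : c \subset M ->
  covered (marked_interval @: c) (a + g) =
  [exists o in c, mpos o <= g < mpos o + mlen o - 1]%N.
Proof.
move=> cM; apply/existsP/existsP => [[_ /andP[/imsetP[o oc ->]]]|[o /andP[oc]]].
  have [-> -> e] := marked_interval_val (subsetP cM _ oc).
  by move=> h; exists o; rewrite oc /=; lia.
have [e1 e2 e3] := marked_interval_val (subsetP cM _ oc).
by exists (marked_interval o); rewrite imset_f //= e1 e2; lia.
Qed.

Lemma marked_interval_cover (c : {set marked k}) : c \subset M ->
  covers (marked_interval @: c) a (a + k) =
  [forall j : 'I_k, (1 <= j)%N ==>
     [exists o in c, mpos o <= j < mpos o + mlen o - 1]%N].
Proof.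
move=> cM; apply/forallP/forallP => cov j; apply/implyP => jk.
  rewrite -covered_marked_interval //.
  have aj : (a + j < N.+1)%N by have := ltn_ord j; lia.
  have /implyP := cov (Ordinal aj); apply => /=.
  by have := ltn_ord j; lia.
have ja : (j - a < k)%N by lia.
have -> : (j : nat) = (a + (j - a))%N by lia.
rewrite covered_marked_interval //.
have /implyP := cov (Ordinal ja); apply => /=; lia.
Qed.

Lemma sum_interval_sets :
  \sum_(S : {set 'I_N.+1 * 'I_N.+1} |
        S \subset intervals N (word_occ w) a (a + k))
    y ^+ #|S| = (1 + y) ^+ occ Gamma (stdperm k (drop a w)).
Proof.
rewrite sum_subsets -marked_interval_imset card_in_imset //.
exact: marked_interval_inj.
Qed.

(* A single letter has no cluster, but counts as a block of the cluster
   decomposition. *)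
Definition block_weight (n : nat) (u : seq nat) : R :=
  if n == 1%N then 1 else \sum_(c in clusters Gamma (stdperm n u)) y ^+ #|c|.

Lemma sum_interval_clusters : (0 < k)%N ->
  \sum_(S : {set 'I_N.+1 * 'I_N.+1} |
        (S \subset intervals N (word_occ w) a (a + k)) && covers S a (a + k))
    y ^+ #|S| = block_weight k (drop a w).
Proof.
move=> k0; rewrite -marked_interval_imset.
rewrite (@sum_subsets_imset _ _ _ _ _ _ (fun S => covers S a (a + k)));
  last exact: marked_interval_inj.
rewrite /block_weight; case: eqP => [k1|k1].
  (* Patterns have length at least 2, so none fits in one letter; the empty set alone remains, with
     weight 1. *)
  have M0 : M = set0.
    apply/setP => o; rewrite [in RHS]inE; apply/negP => /marked_interval_val[_ _].
    by move: k1; lia.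
  rewrite -/M M0 (big_pred1 set0) ?cards0 // => c.
  rewrite subset0 /=; case: eqP => [->|] //=.
  by apply/forallP => g; apply/implyP; lia.
apply: eq_bigl => c; rewrite inE /is_cluster.
case cM: (c \subset M); last by rewrite andbF.
rewrite marked_interval_cover //=; case: eqP => //= ->.
(* The empty set leaves place 1 uncovered. *)
have k2 : (1 < k)%N by lia.
apply/forallP => /(_ (Ordinal k2))/implyP/(_ isT)/existsP[o].
by rewrite inE.
Qed.

End Transport.

(** Cut the interval sets on [[0, n]] at the first gap [k]: the left part is a block on the first
    [k] letters, the right part any set of marked occurrences in the rest. *)
Theorem word_cluster_recurrence n w : (0 < n)%N ->
  (1 + y) ^+ occ Gamma (stdperm n w) =
  \sum_(1 <= k < n.+1)
     block_weight k w * (1 + y) ^+ occ Gamma (stdperm (n - k) (drop k w)).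
Proof.
move=> n0; rewrite -[in LHS](drop0 w) -(@sum_interval_sets n n 0) //.
rewrite interval_recurrence ?n0 //=; last exact: word_occ_ltn.
rewrite big_geq_mkord; apply: eq_big => [k|k /andP[k0 kn]].
  by have := ltn_ord k; rewrite ltnS => ->; rewrite andbT.
rewrite -(@sum_interval_sets n) ?subnKC // -[in block_weight _ w](drop0 w).
by rewrite -(@sum_interval_clusters n k 0) ?add0n.
Qed.

End WordClusters.

(** * Summation over all words of a given length *)

Section WordSums.
Variable Gamma : forall m, {set 'S_m}.
Hypothesis Gamma_ge2 : forall m (sigma : 'S_m), sigma \in Gamma m -> (2 <= m)%N.
Variables (R : comNzRingType) (y q : R) (b : nat).

(** The [W_n] of the cluster expansion, with [1 + y] for [s]; [block_sum] is [G_n]. *)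
Definition occ_sum (n : nat) : R :=
  \sum_(w <- words b n) q ^+ sumn w * (1 + y) ^+ occ Gamma (stdperm n w).

Definition block_sum (n : nat) : R :=
  \sum_(w <- words b n) q ^+ sumn w * block_weight Gamma y n w.

Lemma occ_sum0 : occ_sum 0 = 1.
Proof.
rewrite /occ_sum big_seq1 /= mul1r (_ : occ _ _ = 0%N) ?expr0 //.
apply/eqP; rewrite cards_eq0; apply/eqP/setP => o; rewrite [in RHS]inE.
by rewrite mem_marked_occ; apply/negP => /and4P[/Gamma_ge2]; lia.
Qed.

(** Cut each word after [k] letters: the sum of letters is additive, and each weight depends on one
    of the two pieces only. *)
Lemma occ_sum_recurrence n : (0 < n)%N ->
  occ_sum n = \sum_(1 <= k < n.+1) block_sum k * occ_sum (n - k).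
Proof.
move=> n0; rewrite {1}/occ_sum.
under eq_bigr => w _ do rewrite (word_cluster_recurrence Gamma_ge2) // mulr_sumr.
rewrite exchange_big /=; apply: eq_big_nat => k /andP[_ kn].
rewrite -{1}(subnKC (kn : (k <= n)%N)) big_words_cat /block_sum big_distrl /=.
apply: eq_big_seq => u; rewrite mem_words => /andP[/eqP su _].
rewrite /occ_sum big_distrr /=; apply: eq_bigr => v _.
by rewrite sumn_cat exprD /block_weight stdperm_cat // drop_size_cat // mulrACA.
Qed.

End WordSums.

(** * Coefficients of [t^b] in the quotients *)

Section Quotient.
Variables (R : comUnitRingType) (q : R).
Let t := fpsX R.
Let Q := fpsC q.

Lemma fps_unitE (f : fps R) : (f \is a GRing.unit) = (f 0%N \is a GRing.unit).
Proof. by []. Qed.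

Lemma geom_series : (1 - t)^-1 = Fps (fun _ => 1).
Proof.
have U : 1 - t \is a GRing.unit.
  by rewrite fps_unitE fpsDE fpsNE fps1E /= subr0 unitr1.
have -> : Fps (fun _ => 1) = chain_series (1 : R) [::].
  by apply: fpsP => b /=; rewrite chain_sum_nil.
by apply: (mulIr U); rewrite (mulVr U) chain_series_nil.
Qed.

Lemma prod_unit n : \prod_(0 <= i < n.+1) (1 - t * Q ^+ i) \is a GRing.unit.
Proof.
apply: rpred_prod => i _.
by rewrite fps_unitE fpsDE fpsNE fps1E fpsXM0 /= subr0 unitr1.
Qed.

(** Sort the words by standardization and apply [words_series_prod] to each class. A general [Phi]
    serves both sides of the theorem. *)
Lemma perm_sum_quotient n (Phi : 'S_n -> R) b : (0 < n)%N ->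
  ((\sum_(p : 'S_n) fpsC (Phi p) * (t ^+ (ides p).+1 * Q ^+ icomaj p)) /
     \prod_(0 <= i < n.+1) (1 - t * Q ^+ i)) b =
  \sum_(w <- words b n) q ^+ sumn w * Phi (stdperm n w).
Proof.
move=> n0; rewrite mulr_suml.
transitivity ((\sum_(p : 'S_n) fpsC (Phi p) *
    Fps (fun b => \sum_(w <- words b n | stdperm n w == p) q ^+ sumn w)) b).
  congr (fps_coef _ b); apply: eq_bigr => p _.
  by rewrite -(words_series_prod q p n0) -mulrA mulrK ?prod_unit.
rewrite fps_sumE [RHS](partition_big (stdperm n) predT) //.
apply: eq_bigr => p _; rewrite fpsCM /= mulr_sumr.
by apply: eq_bigr => w /eqP->; rewrite mulrC.
Qed.

End Quotient.

(** * Congruences modulo powers of [x], and summability *)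

Section Order.

Definition xorder (N : nat) (f : pssqx) : Prop :=
  forall a c d, (d < N)%N -> (((f : fps psqx) a : fps psx) c : fps rat) d = 0.

Lemma xorderD N f g : xorder N f -> xorder N g -> xorder N (f + g).
Proof. by move=> hf hg a c d dN; rewrite !fpsDE hf ?hg ?addr0. Qed.

Lemma xorderN N f : xorder N f -> xorder N (- f).
Proof. by move=> hf a c d dN; rewrite !fpsNE hf ?oppr0. Qed.

Lemma xorderB N f g : xorder N f -> xorder N g -> xorder N (f - g).
Proof. by move=> hf /xorderN; exact: xorderD. Qed.

Lemma xorder_sum N I (r : seq I) (P : pred I) (F : I -> pssqx) :
  (forall i, P i -> xorder N (F i)) -> xorder N (\sum_(i <- r | P i) F i).
Proof. by move=> hF; elim/big_rec: _ => // i f Pi; apply: xorderD; exact: hF. Qed.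

Lemma xorderM M N f g : xorder M f -> xorder N g -> xorder (M + N) (f * g).
Proof.
move=> hf hg a c d dMN; rewrite fpsME !fps_sumE big1 // => i _.
rewrite fpsME !fps_sumE big1 // => j _; rewrite fpsME big1 // => k _.
have [kM|Mk] := ltnP k M; first by rewrite hf ?mul0r.
by rewrite hg ?mulr0 //; have := ltn_ord k; lia.
Qed.

Lemma xorderMl N f g : xorder N f -> xorder N (g * f).
Proof. by move=> hf; rewrite -[N]add0n; apply: xorderM. Qed.

Lemma xorderX N f n : xorder 1 f -> (N <= n)%N -> xorder N (f ^+ n).
Proof.
move=> hf Nn; rewrite -(subnK Nn) exprD; apply: xorderMl.
by elim: N {Nn} => // N IHN; rewrite exprS -add1n; apply: xorderM.
Qed.

(* The variable x, as an element of Q[[s,q,x]]. *)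
Definition x3 : pssqx := fpsC (fpsC (fpsX rat : psx) : psqx).

Lemma xorder_x3 : xorder 1 x3.
Proof. by case=> [|a] [|c] [|d]. Qed.

Lemma xorder_horner (r : {poly pssqx}) N :
  (forall i, (i < N)%N -> r`_i = 0) -> xorder N r.[x3].
Proof.
move=> r0; rewrite horner_coef; apply: xorder_sum => i _.
have [iN|Ni] := ltnP i N; first by rewrite r0 ?mul0r.
by apply/xorderMl/xorderX => //; exact: xorder_x3.
Qed.

(* Modulo x^N, W = 1 + G W and hence W = 1/(1-G) = \sum_n G^n. *)
Lemma geometric_xorder (W G : nat -> pssqx) (F : pssqx) N :
    W 0%N = 1 ->
    (forall n, (0 < n)%N -> W n = \sum_(1 <= k < n.+1) G k * W (n - k)%N) ->
    xorder 1 F -> xorder N (F - \sum_(1 <= k < N) G k * x3 ^+ k) ->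
  xorder N (\sum_(0 <= n < N) W n * x3 ^+ n - \sum_(0 <= n < N) F ^+ n).
Proof.
move=> W0 Wn F1 FG.
set L := \sum_(0 <= n < N) W n * _; set S := \sum_(0 <= n < N) F ^+ n.
case: N => [|N] in FG L S *; first by [].
(* Truncation to polynomials turns the recurrence into an identity of the coefficients below [N.+1],
   then evaluated at [x3]. *)
pose pL := \poly_(n < N.+1) W n.
pose pG := \poly_(n < N.+1) (if n == 0%N then 0 else G n).
have LE : L = pL.[x3] by rewrite horner_poly /L big_mkord.
have GE : \sum_(1 <= k < N.+1) G k * x3 ^+ k = pG.[x3].
  rewrite horner_poly big_ord_recl /= mul0r add0r big_add1 big_mkord.
  by apply: eq_bigr.
have rec : xorder N.+1 (pL - 1 - pG * pL).[x3].
  apply: xorder_horner => -[|i] iN; rewrite !coefB coef1 coefM coef_poly /=.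
    by rewrite W0 big_ord1 coef_poly /= mul0r !subr0 subrr.
  rewrite iN subr0 Wn // big_ord_recl coef_poly /= mul0r add0r big_add1 big_mkord.
  apply/eqP; rewrite subr_eq0; apply/eqP/eq_bigr => j _.
  have jN : (j.+1 < N.+1)%N by exact: leq_ltn_trans (ltn_ord j) iN.
  rewrite !coef_poly jN /=; case: ifP => //.
  by rewrite /bump /=; lia.
have {rec}FL : xorder N.+1 ((1 - F) * L - 1).
  have -> : (1 - F) * L - 1 =
      (pL - 1 - pG * pL).[x3] - L * (F - pG.[x3]).
    rewrite !hornerE -LE; ring.
  by apply: xorderB rec _; apply: xorderMl; rewrite -GE.
(* This follows from [S (1 - F) = 1 - F^(N+1)]; both summands vanish modulo [x^(N+1)], the last
   because [F] has no constant term in [x]. *)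
have -> : L - S = S * ((1 - F) * L - 1) + L * F ^+ N.+1.
  have -> : F ^+ N.+1 = 1 - S * (1 - F).
    have := subrX1 F N.+1; rewrite -(big_mkord xpredT) -/S => e.
    by rewrite -[LHS](subrK 1) e; ring.
  ring.
apply: xorderD; first exact: xorderMl.
by apply: xorderMl; apply: xorderX.
Qed.

Section XSummable.
Variables (m : nat) (u : nat -> psstqx).
Hypothesis u_xorder : forall k b, (m <= k)%N -> xorder k ((u k : fps pssqx) b).

Lemma coef4_sum I (r : seq I) (P : pred I) (F : I -> psstqx) a b c d :
  coef4 (\sum_(i <- r | P i) F i) a b c d =
  \sum_(i <- r | P i) coef4 (F i) a b c d.
Proof. by rewrite /coef4 !fps_sumE. Qed.

Lemma coef4_partial_sum N N' a b c d : (d < N <= N')%N ->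
  coef4 (\sum_(m <= k < N') u k) a b c d = coef4 (\sum_(m <= k < N) u k) a b c d.
Proof.
case/andP=> dN NN'; rewrite !coef4_sum (big_nat_widen _ _ _ _ _ NN').
rewrite [RHS]big_mkcond /=; apply: eq_big_nat => k /andP[mk _].
by case: ltnP => // Nk; apply: u_xorder => //; exact: leq_trans Nk.
Qed.

(** Terms with [k > d] do not reach [x^d], so this coefficient is final in the partial sum below
    [d.+1]. *)
Lemma xorder_summable : fps_summable m u.
Proof.
pose S : psstqx := Fps (fun b => Fps (fun a => Fps (fun c => Fps (fun d =>
  coef4 (\sum_(m <= k < d.+1) u k) a b c d)))).
exists S => a b c d; exists d.+1 => N dN.
by rewrite (@coef4_partial_sum d.+1) // leqnn.
Qed.

Lemma coef4_fps_sum N a b c d : (d < N)%N ->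
  coef4 (fps_sum m u) a b c d = coef4 (\sum_(m <= k < N) u k) a b c d.
Proof.
move=> dN; have [N0 uN0] := fps_sumP xorder_summable a b c d.
by rewrite -(uN0 _ (leq_maxl N0 N)) (coef4_partial_sum (N := N)) // dN leq_maxr.
Qed.

Lemma xorder_fps_sum N b :
  xorder N ((fps_sum m u : fps pssqx) b - \sum_(m <= k < N) (u k : fps pssqx) b).
Proof.
move=> a c d dN; rewrite !fpsDE !fpsNE -fps_sumE.
by apply/eqP; rewrite subr_eq0; apply/eqP/coef4_fps_sum.
Qed.

End XSummable.

End Order.

(** * Comparison of both sides at fixed [t^b] *)

Theorem theorem3p7 (Gamma : forall m : nat, {set 'S_m})
    (Gamma_ge2 : forall (m : nat) (sigma : 'S_m),
        sigma \in Gamma m -> (2 <= m)%N) :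
  let s := vs in let t := vt in let q := vq in let x := vx in
  let P (n : nat) : psstqx := \prod_(0 <= i < n.+1) (1 - t * q ^+ i) in
  let lhs_term (n : nat) : psstqx := A_poly Gamma n s t q / P n * x ^+ n in
  let cluster_term (k : nat) : psstqx :=
    R_poly Gamma k (s - 1) t q * (x ^+ k / P k) in
  let F : psstqx :=
    t * x / ((1 - t) * (1 - t * q)) + fps_sum 2 cluster_term in
  let rhs_term (n : nat) : psstqx := hadamard_exp F n in
  [/\ fps_summable 2 cluster_term,
      fps_summable 0 lhs_term,
      fps_summable 0 rhs_term &
      fps_sum 0 lhs_term = fps_sum 0 rhs_term].
Proof.
move=> s t q x P lhs_term cluster_term F rhs_term.
pose s3 : pssqx := fpsX psqx; pose q3 : pssqx := fpsC (fpsX psx : psqx).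
(* Taking [y = s - 1] makes [1 + y] the variable [s]. *)
pose W b := occ_sum Gamma (s3 - 1) q3 b.
pose G b := block_sum Gamma (s3 - 1) q3 b.
have xn n : x ^+ n = fpsC (x3 ^+ n) :> fps pssqx by rewrite rmorphXn.
have lhsE n b : (lhs_term n : fps pssqx) b = W b n * x3 ^+ n.
  rewrite /lhs_term /A_poly xn mulrC fpsCM mulrC; congr (_ * _).
  case: n => [|n].
    rewrite eqxx div1r /P big_nat1 expr0 mulr1.
    have -> : (1 - t)^-1 = Fps (fun _ => 1) :> fps pssqx := geom_series _.
    by rewrite /W occ_sum0.
  have -> : W b n.+1 =
      \sum_(w <- words b n.+1) q3 ^+ sumn w * s3 ^+ occ Gamma (stdperm n.+1 w).
    by rewrite /W /occ_sum addrC subrK.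
  have e := perm_sum_quotient (n := n.+1) q3 (fun p => s3 ^+ occ Gamma p) b isT.
  refine (etrans _ e).
  congr (fps_coef (_ / _) b); apply: eq_bigr => p _.
  by rewrite rmorphXn mulrA.
have clE k b : (1 < k)%N -> (cluster_term k : fps pssqx) b = G b k * x3 ^+ k.
  move=> k1; rewrite /cluster_term /R_poly xn mulrCA fpsCM mulrC; congr (_ * _).
  rewrite /G /block_sum /block_weight gtn_eqF //.
  apply: etrans (perm_sum_quotient q3
    (fun p => \sum_(c in clusters Gamma p) (s3 - 1) ^+ #|c|) b (ltnW k1)).
  congr (fps_coef (_ / _) b); apply: eq_bigr => p _.
  rewrite mulrC; congr (_ * _); rewrite rmorph_sum; apply: eq_bigr => c _.
  by rewrite rmorphXn rmorphB rmorph1.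
(* The single-letter block: the only permutation in ['S_1] has no descent, which gives the numerator
   [t]. *)
have FE1 b : (t * x / ((1 - t) * (1 - t * q)) : fps pssqx) b = G b 1%N * x3.
  have -> : x = fpsC (x3 ^+ 1) :> fps pssqx by rewrite -xn expr1.
  rewrite (mulrC t) -mulrA fpsCM expr1 mulrC; congr (_ * _).
  have e := perm_sum_quotient q3 (fun _ : 'S_1 => 1) b isT.
  refine (etrans (etrans _ e) _); last first.
    by apply: eq_bigr => w _; rewrite /block_weight eqxx.
  have des0 (p : 'S_1) : (ides p = 0)%N /\ (icomaj p = 0)%N.
    by rewrite /ides /icomaj /des /comaj !big_geq.
  congr (fps_coef (_ / _) b).
    under eq_bigr => p _ do
      rewrite (des0 p).1 (des0 p).2 rmorph1 mul1r expr0 mulr1 expr1.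
    by rewrite sumr_const card_Sn.
  by rewrite (big_ltn (isT : (0 < 2)%N)) big_nat1 expr0 mulr1 expr1.
have cl_xorder k b : (2 <= k)%N -> xorder k ((cluster_term k : fps pssqx) b).
  move=> k2; rewrite clE //; apply/xorderMl/xorderX => //; exact: xorder_x3.
have lhs_xorder k b : (0 <= k)%N -> xorder k ((lhs_term k : fps pssqx) b).
  move=> _; rewrite lhsE; apply/xorderMl/xorderX => //; exact: xorder_x3.
have FN N b : xorder N ((F : fps pssqx) b - \sum_(1 <= k < N) G b k * x3 ^+ k).
  have clN := @xorder_fps_sum 2 cluster_term cl_xorder N b.
  rewrite fpsDE FE1; case: N clN => [|[|N]] clN; first by [].
    rewrite big_geq // subr0; apply: xorderD; first exact/xorderMl/xorder_x3.
    by move: clN; rewrite big_geq // subr0.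
  rewrite big_ltn // expr1 opprD addrACA subrr add0r.
  move: clN; congr (xorder _ (_ - _)); apply: eq_big_nat => k /andP[k2 _].
  exact: clE.
have F1 b : xorder 1 ((F : fps pssqx) b).
  by have := FN 1%N b; rewrite big_geq // subr0.
(* At fixed [b] the Hadamard power is an ordinary power, and its unit [1/(1 - t)] has all
   coefficients 1. *)
have rhsE n b : (rhs_term n : fps pssqx) b = (F : fps pssqx) b ^+ n.
  elim: n => [|n IHn].
    have -> : rhs_term 0%N = Fps (fun _ => 1) :> fps pssqx := geom_series _.
    by rewrite expr0.
  by rewrite exprS -IHn.
have rhs_xorder k b : (0 <= k)%N -> xorder k ((rhs_term k : fps pssqx) b).
  by move=> _; rewrite rhsE; exact: xorderX.
split; [exact: xorder_summable|exact: xorder_summable|exact: xorder_summable|].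
(* Both coefficients of [x^d] are read from partial sums below [d.+1], which agree modulo
   [x^(d+1)]. *)
apply: fpsP => b; apply: fpsP => a; apply: fpsP => c; apply: fpsP => d.
have lhs_sum : (\sum_(0 <= n < d.+1) lhs_term n : fps pssqx) b =
    \sum_(0 <= n < d.+1) W b n * x3 ^+ n.
  by rewrite fps_sumE; apply: eq_bigr => n _; exact: lhsE.
have rhs_sum : (\sum_(0 <= n < d.+1) rhs_term n : fps pssqx) b =
    \sum_(0 <= n < d.+1) (F : fps pssqx) b ^+ n.
  by rewrite fps_sumE; apply: eq_bigr => n _; exact: rhsE.
have := coef4_fps_sum lhs_xorder a b c (ltnSn d).
have := coef4_fps_sum rhs_xorder a b c (ltnSn d).
rewrite /coef4 lhs_sum rhs_sum => -> ->.
have := @geometric_xorder (W b) (G b) _ d.+1 (occ_sum0 Gamma_ge2 _ _ _)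
  (fun n => @occ_sum_recurrence _ Gamma_ge2 _ _ _ _ n)
  (F1 b) (FN d.+1 b) a c d (ltnSn d).
by rewrite !fpsDE !fpsNE => /eqP; rewrite subr_eq0 => /eqP.
Qed.
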